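(* Let $X$ be a Hausdorff space, let $(Y,\mathcal{U})$ be a complete uniform space which, with the topology induced by $\mathcal{U}$, is closed-homogeneous, and let $\lambda$ be a $\pi$-network for $X$. Suppose that $C_{\hat{\mathcal{U}}|\lambda}(X,Y)=C_{\lambda}(X,Y)$, i.e. the topology on $C(X,Y)$ induced by the uniformity $\hat{\mathcal{U}}|\lambda$ coincides with the $\lambda$-open topology. Then the family $\lambda$ consists of $Y$-compact sets, i.e. every $A\in\lambda$ is a $Y$-compact subset of $X$.
   Context: $C(X,Y)$ is the set of all continuous maps from $X$ to $Y$, where $Y$ carries the topology induced by $\mathcal{U}$. A family $\lambda$ of non-empty subsets of $X$ is a $\pi$-network for $X$ if every non-empty open set $U\subseteq X$ contains some $A\in\lambda$. The uniformity $\hat{\mathcal{U}}|\lambda$ on $C(X,Y)$ is the one generated by the base consisting of all finite intersections of sets of the form $\hat{V}|A=\{(f,g): (f(x),g(x))\in V \text{ for every } x\in A\}$ with $V\in\mathcal{U}$ and $A\in\lambda$. $C_{\hat{\mathcal{U}}|\lambda}(X,Y)$ denotes $C(X,Y)$ with the topology induced by $\hat{\mathcal{U}}|\lambda$. The $\lambda$-open (set-open) topology on $C(X,Y)$ has as a subbase all sets $[A,U]=\{f\in C(X,Y): f(A)\subseteq U\}$, with $A\in\lambda$ and $U$ open in $Y$. $C_{\lambda}(X,Y)$ denotes $C(X,Y)$ with this topology. A topological space $Y$ is closed-homogeneous if for any $x,y\in Y$ and any closed subset $K$ of $Y$ with $K\subseteq Y\setminus\{x,y\}$, there is a homeomorphism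 $f:Y\to Y$ that is the identity on $K$ and satisfies $f(x)=y$. A subset $A\subseteq X$ is $Y$-compact if $f(A)$ is compact for every $f\in C(X,Y)$. *)

(* Defs.v *)
From HB Require Import structures.
From mathcomp Require Import all_boot all_order all_algebra.
From mathcomp Require Import finmap all_classical.
From mathcomp Require Import topology.

Set Implicit Arguments.
Unset Strict Implicit.
Unset Printing Implicit Defensive.

Local Open Scope classical_set_scope.
Local Open Scope relation_scope.

Definition pi_network (X : topologicalType) (lam : set (set X)) : Prop :=
  (forall A, lam A -> A !=set0) /\
  (forall U : set X, open U -> U !=set0 -> exists2 A, lam A & A `<=` U).

Definition homeomorphism (X Y : topologicalType) (f : X -> Y) : Prop :=
  continuous f /\
  exists g : Y -> X, [/\ continuous g, cancel f g & cancel g f].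

Definition closed_homogeneous (Y : topologicalType) : Prop :=
  forall (x y : Y) (K : set Y), closed K -> K `<=` ~` [set x; y] ->
    exists f : Y -> Y,
      [/\ homeomorphism f, (forall z, K z -> f z = z) & f x = y].

(* The library's [completeType] is the same condition on a pointed carrier;
   here the uniform space may be empty. *)
Definition complete_space (Y : uniformType) : Prop :=
  forall F : set_system Y, ProperFilter F -> cauchy F ->
    exists y : Y, F --> y.

Definition Y_compact (X Y : topologicalType) (A : set X) : Prop :=
  forall f : continuousType X Y, compact (f @` A).

Definition setopen (X Y : topologicalType) (A : set X) (U : set Y) :
    set (continuousType X Y) :=
  [set f : continuousType X Y | f @` A `<=` U].

(* [C_setopen Y lam] is C(X, Y) with the lam-open topology. *)
Definition C_setopen (X Y : topologicalType) (lam : set (set X)) : Type :=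
  continuousType X Y.

HB.instance Definition _ (X Y : topologicalType) (lam : set (set X)) :=
  Choice.copy (C_setopen Y lam) (continuousType X Y).

HB.instance Definition _ (X Y : topologicalType) (lam : set (set X)) :=
  isSubBaseTopological.Build (C_setopen Y lam)
    [set p : set X * set Y | lam p.1 /\ open p.2]
    (fun p => setopen p.1 p.2).

Definition unif_on (X : topologicalType) (Y : uniformType)
    (V : set (Y * Y)) (A : set X) :
    set (continuousType X Y * continuousType X Y) :=
  [set fg : continuousType X Y * continuousType X Y |
    forall x, A x -> V (fg.1 x, fg.2 x)].

(* [C_unif Y lam] is C(X, Y) with the uniformity whose base is the set of finite
   intersections of the [unif_on V A] (V an entourage, A in lam). *)
Definition C_unif (X : topologicalType) (Y : uniformType)
    (lam : set (set X)) : Type :=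
  continuousType X Y.

HB.instance Definition _ (X : topologicalType) (Y : uniformType)
    (lam : set (set X)) :=
  Choice.copy (C_unif Y lam) (continuousType X Y).

Section C_unif_uniform.
Context (X : topologicalType) (Y : uniformType) (lam : set (set X)).

Definition C_unif_base : set_system (C_unif Y lam * C_unif Y lam) :=
  finI_from [set p : set (Y * Y) * set X | entourage p.1 /\ lam p.2]
    (fun p => unif_on p.1 p.2).

Definition C_unif_ent : set_system (C_unif Y lam * C_unif Y lam) :=
  filter_from C_unif_base id.

Lemma C_unif_ent_filter : Filter C_unif_ent.
Proof.
apply: filter_from_filter.
  exists setT, fset0%fset => //; by rewrite set_fset0 bigcap_set0.
by move=> P Q BP BQ; exists (P `&` Q) => //; exact: finI_fromI.
Qed.

Lemma C_unif_ent_diagonal E : C_unif_ent E -> diagonal `<=` E.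
Proof.
move=> [_ [F FD <-] FE] [f g] /diagonalP ->; apply: FE => p pF x _.
by have := FD p pF; rewrite inE => -[/entourage_refl + _]; exact.
Qed.

Lemma C_unif_ent_preim (h : set (Y * Y) -> set (Y * Y)) (F : {fset set (Y * Y) * set X}) :
    (forall V, entourage V -> entourage (h V)) ->
    {subset F <= [set p : set (Y * Y) * set X | entourage p.1 /\ lam p.2]} ->
  C_unif_ent (\bigcap_(p in [set` F]) unif_on (h p.1) p.2).
Proof.
move=> hE FD; exists (\bigcap_(p in [set` F]) unif_on (h p.1) p.2) => //.
exists [fset (h p.1, p.2) | p in F]%fset.
  move=> _ /imfsetP[p pF ->]; rewrite inE /=.
  by have := FD p pF; rewrite inE => -[/hE].
rewrite eqEsubset; split=> fg H p.
  by move=> pF; apply: (H (h p.1, p.2)); apply/imfsetP; exists p.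
by move=> /imfsetP[q qF ->]; exact: H.
Qed.

Lemma C_unif_ent_inv E : C_unif_ent E -> C_unif_ent E^-1.
Proof.
move=> [_ [F FD <-] FE].
apply: (@filterS _ _ C_unif_ent_filter); last first.
  by apply: (@C_unif_ent_preim (fun V => V^-1)%relation) FD => V; exact: entourage_inv.
by move=> [f g] H; apply: FE => p pF x Ax; exact: H.
Qed.

Lemma C_unif_ent_split E :
  C_unif_ent E -> exists2 E', C_unif_ent E' & E' \; E' `<=` E.
Proof.
move=> [_ [F FD <-] FE].
exists (\bigcap_(p in [set` F]) unif_on (split_ent p.1) p.2).
  by apply: C_unif_ent_preim FD => V; exact: entourage_split_ent.
move=> [f g] [h Hfh Hhg]; apply: FE => p pF x Ax.
have := FD p pF; rewrite inE => -[pE _].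
by apply: (entourage_split (h x)) => //; [exact: Hfh|exact: Hhg].
Qed.

HB.instance Definition _ := isUniform.Build (C_unif Y lam)
  C_unif_ent_filter C_unif_ent_diagonal C_unif_ent_inv C_unif_ent_split.

End C_unif_uniform.

(* The two topologies, as families of open sets on the same carrier. *)
Definition unif_topology (X : topologicalType) (Y : uniformType)
    (lam : set (set X)) : set_system (continuousType X Y) :=
  @open (C_unif Y lam).

Definition setopen_topology (X Y : topologicalType) (lam : set (set X)) :
    set_system (continuousType X Y) :=
  @open (C_setopen Y lam).

Arguments unif_topology {X} Y lam _.
Arguments setopen_topology {X} Y lam _.

(* Main.v *)
From HB Require Import structures.
Require Import Defs.
From mathcomp Require Import all_boot all_order all_algebra.
From mathcomp Require Import finmap all_classical.
From mathcomp Require Import topology.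

Set Implicit Arguments.
Unset Strict Implicit.
Unset Printing Implicit Defensive.

Local Open Scope classical_set_scope.

(** Fix A in lam and f : X -> Y continuous. Closed-homogeneity supplies, for any
two points x and y of an open set O, a continuous h : Y -> Y that sends x to y
and fixes Y \ O pointwise while preserving O ([closed_homogeneous_push]).
Replacing f by h \o f is thus a perturbation of f confined to O, and testing
the two topologies on such perturbations gives two properties of f(A).

- [closure_image_sub]: every open U containing f(A) contains the closure of
  f(A). The subbasic set [A, U] is a uniform neighbourhood of f, so it contains
  all g that are W-close to f everywhere, for some entourage W. If y is in the
  closure of f(A), push a point f(a) to y inside a small neighbourhood of y: the
  perturbed map is W-close to f and takes the value y at a, whence y is in U.

- [ultra_image_cauchy]: every ultrafilter F containing f(A) is Cauchy; in other
  words f(A) is totally bounded. Given an entourage V, the maps V-close to f on A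
  include a basic set-open neighbourhood [A_1, U_1] & .. & [A_n, U_n] of f. By
  the first property the open sets U_i and Y \ cl f(A_i) cover Y, so F contains
  one of them for each i; let T be the intersection of the chosen ones. A push
  inside T perturbs f within every [A_i, U_i], because T either lies in U_i
  or misses f(A_i). Hence any point f(a) of T can be moved to any other point of
  T with the perturbed map V-close to f on A, and f(A) & T, a member of F, is
  V-small.

Completeness makes such an F converge to a point of the closure of f(A), and the
first property turns this limit into one inside f(A). *)

(** The homeomorphism given by closed-homogeneity with K := ~` O cannot send a
point of O outside O: the image would be a fixed point, against injectivity. *)
Lemma closed_homogeneous_push (Y : topologicalType) (O : set Y) (x y : Y) :
  closed_homogeneous Y -> open O -> O x -> O y ->
  exists h : Y -> Y, [/\ continuous h, h x = y,
    (forall z, ~ O z -> h z = z) & (forall z, O z -> O (h z))].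
Proof.
move=> hom oO Ox Oy.
have [||h [[hc [g [_ hK _]]] hid hx]] := hom x y (~` O).
- exact: open_closedC.
- by move=> z nOz [] zE; apply: nOz; rewrite zE.
exists h; split=> // z Oz; apply: contrapT => nOhz.
have hz : h z = z by apply: (can_inj hK); exact: hid.
by apply: nOhz; rewrite hz.
Qed.

Lemma continuousType_comp (X Y : topologicalType) (f : continuousType X Y)
    (h : Y -> Y) :
  continuous h -> exists g : continuousType X Y, forall x, g x = h (f x).
Proof.
move=> hc.
have hf : continuous (h \o f).
  by move=> x; apply: continuous_comp; [exact: cts_fun|exact: hc].
pose m := isContinuous.Build _ _ _ hf.
by exists (HB.pack_for (continuousType X Y) (h \o f) m).
Qed.

(** A basic entourage involves finitely many entourages of Y, each imposed on one
member of lam; intersecting them and forgetting the members of lam shows that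
uniform closeness to f on all of X suffices. *)
Lemma C_unif_nbhs_close (X : topologicalType) (Y : uniformType)
    (lam : set (set X)) (f : continuousType X Y) (N : set (C_unif Y lam)) :
  nbhs (f : C_unif Y lam) N ->
  exists2 W : set (Y * Y), entourage W &
    forall g : continuousType X Y, (forall x, W (f x, g x)) -> N g.
Proof.
rewrite -nbhs_entourageE => -[E [_ [D DP <-] DE] EN].
exists (\bigcap_(p in [set` D]) p.1).
  by apply: filter_bigI => p /DP; rewrite inE => -[].
move=> g Wfg; apply: EN; rewrite /xsection /= inE; apply: DE => p pD x _.
exact: Wfg.
Qed.

Lemma C_unif_nbhs_unif_on (X : topologicalType) (Y : uniformType)
    (lam : set (set X)) (f : continuousType X Y) (V : set (Y * Y)) (A : set X) :
  entourage V -> lam A ->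
  nbhs (f : C_unif Y lam)
    [set g : continuousType X Y | forall x, A x -> V (f x, g x)].
Proof.
move=> entV lamA; rewrite -nbhs_entourageE.
exists (unif_on V A); last by move=> g; rewrite /xsection /= => /set_mem.
exists (unif_on V A) => //.
exact: (finI_from1 (fun p => unif_on p.1 p.2) (i := (V, A)) (conj entV lamA)).
Qed.

Lemma C_setopen_nbhs_subbase (X Y : topologicalType) (lam : set (set X))
    (f : continuousType X Y) (N : set (C_setopen Y lam)) :
  nbhs (f : C_setopen Y lam) N ->
  exists D : {fset set X * set Y},
    (forall p, p \in D -> [/\ lam p.1, open p.2 & f @` p.1 `<=` p.2]) /\
    (forall g : continuousType X Y,
       (forall p, p \in D -> g @` p.1 `<=` p.2) -> N g).
Proof.
rewrite nbhsE => -[_ [[B BP <-] [I BI If] BN]].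
have [D DP ID] := BP I BI; rewrite -ID in BI If.
exists D; split=> [p pD|g Dg].
  by have /set_mem[] := DP p pD; split=> //; exact: If.
by apply: BN; exists (\bigcap_(p in [set` D]) setopen p.1 p.2).
Qed.

Lemma open_setopen (X Y : topologicalType) (lam : set (set X)) (A : set X)
    (U : set Y) :
  lam A -> open U -> setopen_topology Y lam (setopen A U).
Proof.
move=> lamA oU; exists [set setopen A U]; last by rewrite bigcup_set1.
move=> _ ->.
exact: (finI_from1 (fun p => setopen p.1 p.2) (i := (A, U)) (conj lamA oU)).
Qed.

(** If f(a) is pushed to y within a neighbourhood of y that is small for a
square root of W, then every point moved and its image are both close to y, so
the perturbed map is W-close to f on all of X. *)
Lemma closure_image_sub (X : topologicalType) (Y : uniformType)
    (lam : set (set X)) (A : set X) (U : set Y) (f : continuousType X Y) :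
  closed_homogeneous Y ->
  setopen_topology Y lam `<=` unif_topology Y lam ->
  lam A -> open U -> f @` A `<=` U -> closure (f @` A) `<=` U.
Proof.
move=> hom sub lamA oU fAU y cly.
have [W entW WN] : exists2 W : set (Y * Y), entourage W &
    forall g : continuousType X Y, (forall x, W (f x, g x)) -> g @` A `<=` U.
  apply: (@C_unif_nbhs_close _ _ lam f (setopen A U)).
  by apply: open_nbhs_nbhs; split=> //; apply: sub; exact: open_setopen.
pose S := split_ent W.
have entS : entourage S by exact: entourage_split_ent.
(* Both sections are needed: the moved point is used as the first component of
   S, and its image as the second. *)
pose O := (xsection S y `&` xsection (S^-1)%relation y)^°.
have Oy : O y.
  apply: (@filterI _ (nbhs y)); apply: nbhs_entourage => //.
have [_ [[a Aa <-] Ofa]] := cly _ (open_nbhs_nbhs (conj (open_interior _) Oy)).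
have [h [hc hfa hid hO]] := closed_homogeneous_push hom (open_interior _) Ofa Oy.
have [g gE] := continuousType_comp f hc.
have <- : g a = y by rewrite gE.
apply: (WN g); last by exists a.
move=> x; rewrite gE; have [Ofx|nOfx] := pselect (O (f x)); last first.
  by rewrite hid //; exact: entourage_refl.
apply: (entourage_split y entW).
  by have [_] := interior_subset Ofx; rewrite /xsection /= inE.
by have [+ _] := interior_subset (hO _ Ofx); rewrite /xsection /= inE.
Qed.

(** Total boundedness of f(A), in the form that pairs with completeness. *)
Lemma ultra_image_cauchy (X : topologicalType) (Y : uniformType)
    (lam : set (set X)) (A : set X) (f : continuousType X Y)
    (F : set_system Y) :
  closed_homogeneous Y ->
  setopen_topology Y lam = unif_topology Y lam ->
  lam A -> UltraFilter F -> F (f @` A) -> cauchy F.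
Proof.
move=> hom top lamA uF FfA V entV.
have [D [DP DN]] : exists D : {fset set X * set Y},
    (forall p, p \in D -> [/\ lam p.1, open p.2 & f @` p.1 `<=` p.2]) /\
    (forall g : continuousType X Y, (forall p, p \in D -> g @` p.1 `<=` p.2) ->
       forall x, A x -> V (f x, g x)).
  apply: (@C_setopen_nbhs_subbase _ _ lam f).
  have := C_unif_nbhs_unif_on (lam := lam) f entV lamA.
  rewrite !nbhsE => -[N [oN Nf] NV]; exists N => //; split=> //.
  by move: oN; rewrite -[open N]/(unif_topology Y lam N) -top.
have cl p : p \in D -> closure (f @` p.1) `<=` p.2.
  move=> /DP[lamp op fp]; apply: (closure_image_sub hom _ lamp op fp).
  by rewrite top.
(* A cell lies in the second component of p or misses the image of the first,
   so a push inside it keeps f in the subbasic set of p. *)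
pose cell p := if `[< F p.2 >] then p.2 else ~` closure (f @` p.1).
pose T := \bigcap_(p in [set` D]) cell p.
have FT : F T.
  apply: filter_bigI => p pD; rewrite /cell; case: asboolP => // nF.
  have [//|] := in_ultra_setVsetC p.2 uF.
  by apply: filterS; apply: subsetC; exact: cl.
have oT : open T.
  rewrite openE => z Tz; apply: filter_bigI => p pD.
  apply: open_nbhs_nbhs; split; last exact: Tz.
  rewrite /cell; case: asboolP => _; first by have [] := DP _ pD.
  by apply: closed_openC; exact: closed_closure.
exists (f @` A `&` T, T); first by split=> //; exact: filterI.
move=> [_ y] [/= [[a Aa <-] Tfa] Ty].
have [h [hc hfa hid hT]] := closed_homogeneous_push hom oT Tfa Ty.
have [g gE] := continuousType_comp f hc.
rewrite -hfa -gE; apply: (DN g) => // p pD _ [b pb <-]; rewrite gE.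
have fpb : (f @` p.1) (f b) by exists b.
have [Tfb|nTfb] := pselect (T (f b)); last first.
  by rewrite hid //; have [_ _] := DP _ pD; apply.
have := hT _ Tfb p pD; have := Tfb p pD; rewrite /cell.
case: asboolP => // _ ncl; case: ncl; exact: subset_closure.
Qed.

Theorem theorem5p2 (X : topologicalType) (Y : uniformType)
    (lam : set (set X)) :
  hausdorff_space X ->
  complete_space Y ->
  closed_homogeneous Y ->
  pi_network lam ->
  unif_topology Y lam = setopen_topology Y lam ->
  forall A : set X, lam A -> Y_compact Y A.
Proof.
move=> _ cpl hom _ top A lamA f; rewrite compact_ultra => F uF FfA.
have [y Fy] := cpl F _ (ultra_image_cauchy hom (esym top) lamA uF FfA).
apply: contrapT => nlim.
(* If no point of f(A) is a limit of F, the open sets rejected by F cover f(A),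
   hence also its closure, which contains the limit y. *)
pose U := \bigcup_(O in [set O | open O /\ F (~` O)]) O.
have oU : open U by apply: bigcup_open => O [].
have fAU : f @` A `<=` U.
  move=> z fAz; apply: contrapT => nUz; apply: nlim; exists z; split=> // N.
  rewrite nbhsE => -[O [oO Oz] ON]; apply: (filterS ON).
  have [//|FnO] := in_ultra_setVsetC O uF.
  by case: nUz; exists O.
have cly : closure (f @` A) y.
  by move=> N /Fy FN; apply: (@filter_ex _ F); exact: filterI.
have [O [oO FnO] Oy] : U y.
  by apply: (closure_image_sub hom _ lamA oU fAU cly); rewrite top.
have /Fy FO : nbhs y O by exact: open_nbhs_nbhs.
by have [z []] := filter_ex (filterI FO FnO).
Qed.
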